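(* Let $M=\Gamma(G,u)$ be a divisible $\sigma$-complete MV-algebra with a product $\cdot$ such that $(M,\cdot)$ is an MV-algebra with product. Let $(m,\tau)$ be a dynamical system on $M$ such that $m$ is a continuous, positive state. Let $\mathcal{A}=(a_1,\dots,a_k)$ be a partition of unity in $M$ consisting of idempotent elements. Then for any partition of unity $\mathcal{B}=(b_1,\dots,b_l)$ in $M$, $$h(\mathcal{B},\tau)\le h(\mathcal{A},\tau)+H(\mathcal{B}\,\Vert\,\mathcal{A}),$$ where $$H(\mathcal{B}\,\Vert\,\mathcal{A})=\sum_{i=1}^k\sum_{j=1}^l m(a_i)\,\varphi\!\left(\frac{m(a_i\cdot b_j)}{m(a_i)}\right).$$
   Context: Every MV-algebra is identified (Mundici's theorem) with $M=\Gamma(G,u)=\{h\in G:0\le h\le u\}$, where $G$ is a lattice-ordered Abelian group with strong unit $u$ (for every $g\in G$ there is an integer $n\ge1$ with $nu\ge g$), with operations $\neg g=u-g$, $g\oplus h=u\wedge(g+h)$, $g\odot h=0\vee(g+h-u)$. The symbols $+$ and $\sum$ denote addition in $G$. $M$ is divisible if for every $a\in M$ and every positive integer $n$ there is $b\in M$ with $a=nb$ (the $n$-fold sum in $G$). $M$ is $\sigma$-complete if every countable subset has a supremum in $M$. An element $a$ is idempotent if $a\oplus a=a$. An MV-algebra with product is a pair $(M,\cdot)$ where $\cdot$ is a commutative and associative binary operation on $M$ with: (i) $u\cdot a=a$; (ii) if $a,b,c\in M$ and $a+b\le u$, then $c\cdot a+c\cdot b\le u$ and $c\cdot(a+b)=c\cdot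 a+c\cdot b$. (Every divisible $\sigma$-complete MV-algebra admits such a product.) A dynamical system on $M$ is a pair of mappings $m:M\to[0,1]$, $\tau:M\to M$ such that: (i) if $a,b,c\in M$ and $a=b+c$, then $m(a)=m(b)+m(c)$ and $\tau(a)=\tau(b)+\tau(c)$; (ii) $\tau(u)=u$, $m(u)=1$; (iii) $m(\tau(a))=m(a)$ for all $a\in M$. A state is an additive map $m:M\to[0,1]$ (as in (i)) with $m(u)=1$; it is continuous if $a_n\nearrow a$ in $M$ implies $m(a_n)\to m(a)$, and positive if $m(a)=0$ implies $a=0$. A partition of unity in $M$ is a finite tuple of elements of $M$ whose sum in $G$ is $u$. A common refinement of $n$ partitions of unity $\mathcal{A}^{(1)},\dots,\mathcal{A}^{(n)}$, with $\mathcal{A}^{(s)}=(a^{(s)}_1,\dots,a^{(s)}_{k_s})$, is an array $(c_{i_1\dots i_n})$ of elements of $M$ such that for every $s$ and every $i$ the sum of all $c_{i_1\dots i_n}$ with $i_s=i$ equals $a^{(s)}_i$ (for $n=1$ it is the partition itself); it is itself a partition of unity. Let $\varphi(x)=-x\log x$ for $x>0$ and $\varphi(0)=0$. The entropy of a partition $\mathcal{C}=(c_\iota)_\iota$ is $H(\mathcal{C})=\sum_\iota\varphi(m(c_\iota))$. For a partition $\mathcal{A}=(a_1,\dots,a_k)$, $\tau(\mathcal{A})=(\tau(a_1),\dots,\tau(a_k))$ (again a partition of unity), $\tau^i(\mathcal{A})$ is the $i$-fold iterate, and for $n\ge1$ $$H_n(\mathcal{A},\tau)=\inf\{H(\mathcal{C}):\mathcal{C}\text{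 is a common refinement of }\mathcal{A},\tau(\mathcal{A}),\dots,\tau^{n-1}(\mathcal{A})\},$$ $$h(\mathcal{A},\tau)=\lim_{n\to\infty}\frac1nH_n(\mathcal{A},\tau)\quad\text{(the limit exists)}.$$ In the definition of $H(\mathcal{B}\,\Vert\,\mathcal{A})$, terms with $m(a_i)=0$ are taken to be $0$. *)

(* Defs.v *)
From HB Require Import structures.
From mathcomp Require Import all_boot all_order all_algebra.
From mathcomp Require Import all_classical all_reals all_analysis.

Set Implicit Arguments.
Unset Strict Implicit.
Unset Printing Implicit Defensive.

Import Order.TTheory GRing.Theory Num.Theory.
Import numFieldNormedType.Exports.

Local Open Scope classical_set_scope.
Local Open Scope ring_scope.

(* Lattice-ordered Abelian groups.  The lattice operations are part of the
   mixin, as a new join of Zmodule and Order.Lattice cannot be inserted below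
   the numeric structures of MathComp, which already inherit from both. *)
HB.mixin Record POrderedZmodule_isLGroup G of Num.POrderedZmodule G := {
  lmeet : G -> G -> G;
  ljoin : G -> G -> G;
  le_lmeet : forall x y z : G, (z <= lmeet x y) = (z <= x) && (z <= y);
  ljoin_le : forall x y z : G, (ljoin x y <= z) = (x <= z) && (y <= z);
  lgroup_leD2l : forall z x y : G, x <= y -> z + x <= z + y
}.

#[short(type="lgroupType")]
HB.structure Definition LGroup :=
  { G of Num.POrderedZmodule G & POrderedZmodule_isLGroup G }.

Section LGroupTheory.
Variable G : lgroupType.
Implicit Types x y z t u : G.

Definition strong_unit u := forall g, exists2 n : nat, (0 < n)%N & g <= u *+ n.

Lemma lgroup_leD x y z t : x <= y -> z <= t -> x + z <= y + t.
Proof.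
move=> xy zt; apply: (le_trans (lgroup_leD2l x z t zt)).
by rewrite ![_ + t]addrC lgroup_leD2l.
Qed.

Lemma lgroup_leBlDr x y z : (x - y <= z) = (x <= z + y).
Proof.
by apply/idP/idP => [/lgroup_leD /(_ (lexx y))|/lgroup_leD /(_ (lexx (- y)))];
  rewrite ?subrK ?addrK.
Qed.

Lemma lmeet_lel x y : lmeet x y <= x.
Proof. by have := le_lmeet x y (lmeet x y); rewrite lexx => /esym/andP[]. Qed.

Lemma lmeet_ler x y : lmeet x y <= y.
Proof. by have := le_lmeet x y (lmeet x y); rewrite lexx => /esym/andP[]. Qed.

(* k (u /\ 0) is the infimum of 0, u, .., k u; if 0 <= n u with n > 0 then the
   term n u is redundant for k = n, so n (u /\ 0) = (n - 1) (u /\ 0). *)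
Lemma strong_unit_ge0 u : strong_unit u -> 0 <= u.
Proof.
move=> /(_ 0)[[//|n] _ un0]; pose v := lmeet u 0.
have v_le0 k : v *+ k <= 0.
  elim: k => [|k IH]; rewrite ?mulr0n// mulrS -[0]addr0.
  exact: lgroup_leD (lmeet_ler _ _) IH.
have v_leu k : v *+ k <= u *+ k.
  elim: k => [|k IH]; rewrite ?mulr0n// !mulrS.
  exact: lgroup_leD (lmeet_lel _ _) IH.
have v_inf k y : (forall i, (i <= k)%N -> y <= u *+ i) -> y <= v *+ k.
  elim: k y => [|k IH] y yi; first by rewrite mulr0n -(mulr0n u) yi.
  rewrite mulrS -lgroup_leBlDr le_lmeet !lgroup_leBlDr add0r addrC.
  rewrite -lgroup_leBlDr !IH// => i ik; first exact/yi/leqW.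
  by rewrite lgroup_leBlDr -mulrSr yi.
suff: 0 <= v by move/le_trans; apply; exact: lmeet_lel.
rewrite -(subrr (v *+ n)) lgroup_leBlDr -mulrS; apply: v_inf => i.
rewrite leq_eqVlt => /predU1P[->|]; first exact: le_trans (v_le0 n) un0.
rewrite ltnS => /subnK <-; rewrite mulrnDr -[u *+ i]add0r.
exact: lgroup_leD (v_le0 _) (v_leu _).
Qed.

End LGroupTheory.

(* The MV-algebra Gamma(G, u), with the order inherited from G. *)
Record mv (G : lgroupType) (u : G) := MV {
  mv_val :> G;
  mv_in01 : (0 <= mv_val) && (mv_val <= u)
}.

HB.instance Definition _ (G : lgroupType) (u : G) :=
  [isSub for @mv_val G u].
HB.instance Definition _ (G : lgroupType) (u : G) :=
  [Choice of mv u by <:].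
HB.instance Definition _ (G : lgroupType) (u : G) :=
  [SubChoice_isSubPOrder of mv u by <: with ring_display].

Section MVAlgebra.
Variables (G : lgroupType) (u : G).
Implicit Types a b c : mv u.

Lemma mv_top_subproof (hu : strong_unit u) : (0 <= u) && (u <= u).
Proof. by rewrite strong_unit_ge0 //=. Qed.

Definition mv_top (hu : strong_unit u) : mv u := MV (mv_top_subproof hu).

Lemma mv_oplus_subproof a b :
  (0 <= lmeet u (mv_val a + mv_val b)) && (lmeet u (mv_val a + mv_val b) <= u).
Proof.
case/andP: (mv_in01 a) (mv_in01 b) => a0 au /andP[b0 _].
by rewrite lmeet_lel le_lmeet (le_trans a0 au) -(addr0 0) lgroup_leD.
Qed.

Definition mv_oplus a b : mv u := MV (mv_oplus_subproof a b).

Definition mv_idempotent a := mv_oplus a a = a.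

Definition mv_divisible :=
  forall a (n : nat), (0 < n)%N -> exists b, mv_val a = mv_val b *+ n.

Definition mv_sigma_complete :=
  forall S : set (mv u), countable S -> supremums S !=set0.

(* In the last axiom s stands for a + b, which lies in M iff a + b <= u. *)
Record mv_product (hu : strong_unit u) (op : mv u -> mv u -> mv u) : Prop := {
  mv_productC : commutative op;
  mv_productA : associative op;
  mv_product1 : forall a, op (mv_top hu) a = a;
  mv_productDr : forall a b c s, mv_val s = mv_val a + mv_val b ->
    mv_val (op c a) + mv_val (op c b) <= u /\
    mv_val (op c s) = mv_val (op c a) + mv_val (op c b)
}.

Definition partition_of_unity (I : finType) (a : I -> mv u) :=
  \sum_i mv_val (a i) = u.

(* The array (c_{i_1 ... i_n}) is indexed by the dependent tuples i with
   i_s < k_s for all s. *)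
Definition common_refinement (n : nat) (k : 'I_n -> nat)
    (a : forall s, 'I_(k s) -> mv u)
    (c : {dffun forall s : 'I_n, 'I_(k s)} -> mv u) :=
  forall (s : 'I_n) (j : 'I_(k s)),
    \sum_(i : {dffun forall s : 'I_n, 'I_(k s)} | i s == j) mv_val (c i)
      = mv_val (a s j).

End MVAlgebra.

Section Entropy.
Variables (R : realType) (G : lgroupType) (u : G).
Implicit Types (a b c : mv u) (m : mv u -> R) (tau : mv u -> mv u).

Record state (hu : strong_unit u) m : Prop := {
  state_in01 : forall a, 0 <= m a <= 1;
  stateD : forall a b c, mv_val a = mv_val b + mv_val c -> m a = m b + m c;
  state1 : m (mv_top hu) = 1
}.

Record dynamical_system (hu : strong_unit u) m tau : Prop := {
  dynamical_system_state : state hu m;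
  dynamical_systemD : forall a b c, mv_val a = mv_val b + mv_val c ->
    mv_val (tau a) = mv_val (tau b) + mv_val (tau c);
  dynamical_system1 : tau (mv_top hu) = mv_top hu;
  dynamical_system_invariant : forall a, m (tau a) = m a
}.

Definition state_continuous m :=
  forall (a_ : nat -> mv u) a, {homo a_ : i j / (i <= j)%N >-> i <= j} ->
    supremums (range a_) a -> m (a_ n) @[n --> \oo] --> m a.

Definition state_positive m := forall a, m a = 0 -> mv_val a = 0.

Definition phi (x : R) : R := if 0 < x then - (x * ln x) else 0.

Definition entropy m (I : finType) (c : I -> mv u) : R := \sum_i phi (m (c i)).

(* The infimum is over a nonempty set bounded below by 0 (given a product,
   products of partitions are common refinements). *)
Definition refinement_entropy m tau (k : nat) (A : 'I_k -> mv u) (n : nat) : R :=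
  inf [set entropy m c | c in
    @common_refinement G u n (fun=> k) (fun s i => iter s tau (A i))].

(* The sequence H_n is subadditive, hence the limit exists.  The value at n = 0
   plays no role. *)
Definition dynamical_entropy m tau (k : nat) (A : 'I_k -> mv u) : R :=
  limn (fun n : nat => n%:R^-1 * refinement_entropy m tau A n).

(* Terms with m (A i) = 0 vanish, whatever the value of the quotient. *)
Definition conditional_entropy (op : mv u -> mv u -> mv u) m
    (k l : nat) (A : 'I_k -> mv u) (B : 'I_l -> mv u) : R :=
  \sum_(i < k) \sum_(j < l) m (A i) * phi (m (op (A i) (B j)) / m (A i)).

End Entropy.

(* Main.v *)
Require Import Defs.
From mathcomp Require Import all_boot all_order all_algebra.
From mathcomp Require Import all_classical all_reals all_analysis.

Set Implicit Arguments.
Unset Strict Implicit.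
Unset Printing Implicit Defensive.

Import Order.TTheory GRing.Theory Num.Theory.
Import numFieldNormedType.Exports.

Local Open Scope classical_set_scope.
Local Open Scope ring_scope.

(** The inequality reduces to a coupling argument.  Put
    [e_ij = a_i b_j]; since the product is additive in each argument,
    [sum_j e_ij = a_i] and [sum_i e_ij = b_j], and applying [tau^s] gives
    arrays with marginals [tau^s a_i] and [tau^s b_j] and with the same values
    of [m].

    A common refinement [c] of the [tau^s A], [s < n], can be refined further,
    one [s] at a time, so as to become compatible with each array [tau^s e].  A
    single such step is a coupling ([mv_coupling]): the pieces of [c] that lie
    in [tau^s a_i] and the elements [tau^s e_ij], for [j] varying, have the
    same sum, and two finite families of positive elements with the same sum
    have a common refinement in any lattice-ordered group ([riesz_suml],
    [riesz_sumr]).  On the level of entropies the step adds at most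
    [H(B || A)]: this is the inequality [H(X, Z) <= H(X) + H(Z | p X)] for
    finite random variables, a case of Gibbs' inequality
    ([entropy_chain_le]).  After [n] steps the result refines all the
    [tau^s B], whence [H_n(B) <= H_n(A) + n H(B || A)]
    ([refinement_entropy_conditional]).

    It remains to divide by [n] and pass to the limit.  The limits exist by
    Fekete's lemma ([fekete_cvg]), as [H_n] is subadditive
    ([refinement_entropy_subadditive]): this is the same coupling step, with
    [tau^p] of a refinement of length [q] coupled to a refinement of length
    [p] over the trivial partition. *)

(** * Refinement of sums in a lattice-ordered group *)

Section Riesz.
Variable G : lgroupType.

Lemma lgroup_subr_ge0 (x y : G) : (0 <= x - y) = (y <= x).
Proof.
apply/idP/idP => [/(lgroup_leD2l y)|/(lgroup_leD2l (- y))].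
  by rewrite addr0 addrC subrK.
by rewrite addNr addrC.
Qed.

Lemma lgroup_addr_ge0 (x y : G) : 0 <= x -> 0 <= y -> 0 <= x + y.
Proof. by move=> x0 y0; rewrite -(addr0 0) lgroup_leD. Qed.

Lemma lgroup_sumr_ge0 (I : Type) (r : seq I) (P : pred I) (x : I -> G) :
  (forall i, 0 <= x i) -> 0 <= \sum_(i <- r | P i) x i.
Proof.
move=> x0; apply: (big_ind (fun y : G => 0 <= y)) => //.
exact: lgroup_addr_ge0.
Qed.

Lemma lgroup_ler_sumD1 (I : finType) (P : pred I) (x : I -> G) (i : I) :
  P i -> (forall j, 0 <= x j) -> x i <= \sum_(j | P j) x j.
Proof.
move=> Pi x0; rewrite (bigD1 i)//= -[leLHS]addr0 lgroup_leD//.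
exact: lgroup_sumr_ge0.
Qed.

Lemma lgroup_ler_sum_sub (I : finType) (P : pred I) (x : I -> G) :
  (forall j, 0 <= x j) -> \sum_(j | P j) x j <= \sum_j x j.
Proof.
move=> x0; rewrite [leRHS](bigID P)/= -[leLHS]addr0 lgroup_leD//.
exact: lgroup_sumr_ge0.
Qed.

Lemma lmeet_l (x y : G) : x <= y -> lmeet x y = x.
Proof. by move=> xy; apply/le_anti; rewrite lmeet_lel le_lmeet lexx xy. Qed.

Lemma lmeet_r (x y : G) : y <= x -> lmeet x y = y.
Proof. by move=> xy; apply/le_anti; rewrite lmeet_ler le_lmeet lexx xy. Qed.

(** With [P], [Q] the two terms on the left and [S] the first one on the right,
    [P] and [Q] are below [S], so [P + Q - S] is below both of them, hence
    below [x] and [y]. *)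
Lemma lmeet_supermodular (x x' y y' : G) : x <= x' -> y <= y' ->
  lmeet x y' + lmeet x' y <= lmeet x' y' + lmeet x y.
Proof.
move=> xx' yy'; rewrite [leRHS]addrC -lgroup_leBlDr.
have P : lmeet x y' <= lmeet x' y'.
  by rewrite le_lmeet lmeet_ler (le_trans (lmeet_lel _ _) xx').
have Q : lmeet x' y <= lmeet x' y'.
  by rewrite le_lmeet lmeet_lel (le_trans (lmeet_ler _ _) yy').
rewrite le_lmeet !lgroup_leBlDr; apply/andP; split.
  by rewrite lgroup_leD// lmeet_lel.
by rewrite addrC lgroup_leD// lmeet_ler.
Qed.

Definition partial_sum (I : finType) (x : I -> G) (p : nat) :=
  \sum_(i | (enum_rank i < p)%N) x i.

Lemma partial_sum0 (I : finType) (x : I -> G) : partial_sum x 0 = 0.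
Proof. by rewrite /partial_sum big_pred0. Qed.

Lemma partial_sum_card (I : finType) (x : I -> G) :
  partial_sum x #|I| = \sum_i x i.
Proof. by apply: eq_bigl => i; rewrite ltn_ord. Qed.

Lemma partial_sumS (I : finType) (x : I -> G) (i : I) :
  partial_sum x (enum_rank i).+1 = x i + partial_sum x (enum_rank i).
Proof.
rewrite /partial_sum (bigD1 i) ?ltnS//=; congr (_ + _); apply: eq_bigl => j.
rewrite ltnS ltn_neqAle andbC; congr (_ && _).
by rewrite -(inj_eq enum_rank_inj).
Qed.

Lemma partial_sum_leS (I : finType) (x : I -> G) (i : I) :
  (forall i, 0 <= x i) ->
  partial_sum x (enum_rank i) <= partial_sum x (enum_rank i).+1.
Proof. by move=> x0; rewrite partial_sumS -lgroup_subr_ge0 addrK. Qed.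

Lemma partial_sum_ge0 (I : finType) (x : I -> G) (p : nat) :
  (forall i, 0 <= x i) -> 0 <= partial_sum x p.
Proof. exact: lgroup_sumr_ge0. Qed.

Lemma partial_sum_le (I : finType) (x : I -> G) (p : nat) :
  (forall i, 0 <= x i) -> partial_sum x p <= \sum_i x i.
Proof. exact: lgroup_ler_sum_sub. Qed.

Lemma telescope_enum_rank (I : finType) (f : nat -> G) :
  \sum_(i : I) (f (enum_rank i).+1 - f (enum_rank i)) = f #|I| - f 0.
Proof.
rewrite (reindex (@enum_val I I))/=; last first.
  by exists enum_rank => i _; [exact: enum_valK|exact: enum_rankK].
rewrite -(telescope_sumr f (leq0n _)) big_mkord.
by apply: eq_bigr => i _; rewrite enum_valK.
Qed.

(** An explicit coupling of [x] and [y].  On the real line, with [X] and [Y]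
    the partial sums, [w p q] is the length of the intersection of [0, X_p]
    and [0, Y_q], so that the second difference of [w] is the length of the
    overlap of the [i]-th interval of the subdivision [X] with the [j]-th
    interval of the subdivision [Y].  The formula keeps its properties in
    lattice-ordered groups. *)
Definition riesz (I J : finType) (x : I -> G) (y : J -> G) (i : I) (j : J) :=
  let w p q := lmeet (partial_sum x p) (partial_sum y q) in
  let p := nat_of_ord (enum_rank i) in let q := nat_of_ord (enum_rank j) in
  (w p.+1 q.+1 - w p q.+1) - (w p.+1 q - w p q).

Section RieszTheory.
Variables (I J : finType) (x : I -> G) (y : J -> G).
Hypotheses (x_ge0 : forall i, 0 <= x i) (y_ge0 : forall j, 0 <= y j).
Hypothesis xy : \sum_i x i = \sum_j y j.

Lemma riesz_ge0 i j : 0 <= riesz x y i j.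
Proof.
rewrite /riesz lgroup_subr_ge0 lgroup_leBlDr addrAC -lgroup_leBlDr opprK.
rewrite [leLHS]addrC.
by apply: lmeet_supermodular; exact: partial_sum_leS.
Qed.

Lemma riesz_suml i : \sum_j riesz x y i j = x i.
Proof.
rewrite (telescope_enum_rank J (fun q =>
  lmeet (partial_sum x (enum_rank i).+1) (partial_sum y q) -
  lmeet (partial_sum x (enum_rank i)) (partial_sum y q))).
rewrite partial_sum0 partial_sum_card -xy.
by rewrite !(lmeet_r (partial_sum_ge0 _ _))// subrr subr0
  !(lmeet_l (partial_sum_le _ _))// partial_sumS addrK.
Qed.

Lemma riesz_sumr j : \sum_i riesz x y i j = y j.
Proof.
rewrite /riesz sumrB.
rewrite (telescope_enum_rank I (fun p =>
  lmeet (partial_sum x p) (partial_sum y (enum_rank j).+1))).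
rewrite (telescope_enum_rank I (fun p =>
  lmeet (partial_sum x p) (partial_sum y (enum_rank j)))).
rewrite partial_sum0 partial_sum_card xy.
by rewrite !(lmeet_l (partial_sum_ge0 _ _))// !subr0
  !(lmeet_r (partial_sum_le _ _))// partial_sumS addrK.
Qed.

End RieszTheory.
End Riesz.

(** * Additive maps and couplings in the MV-algebra *)

Section Additive.
Variables (G : lgroupType) (u : G).

Definition mv_additive (V : zmodType) (f : mv u -> V) :=
  forall a b c : mv u, mv_val a = mv_val b + mv_val c -> f a = f b + f c.

Lemma mv_ge0 (a : mv u) : 0 <= mv_val a.
Proof. by case/andP: (mv_in01 a). Qed.

Lemma mv_le (a : mv u) : mv_val a <= u.
Proof. by case/andP: (mv_in01 a). Qed.
#[local] Hint Resolve mv_ge0 mv_le : core.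

Lemma mv_additive_sum (V : zmodType) (f : mv u -> V) (I : finType) (P : pred I)
    (b : I -> mv u) (a : mv u) : mv_additive f ->
  mv_val a = \sum_(i | P i) mv_val (b i) -> f a = \sum_(i | P i) f (b i).
Proof.
move=> fD; elim: (index_enum I) a => [|i r IH] a.
  rewrite !big_nil => a0.
  have /eqP : f a = f a + f a by apply: fD; rewrite a0 addr0.
  by rewrite -subr_eq subrr => /eqP.
rewrite !big_cons; case: ifPn => Pi; last exact: IH.
set s := (X in _ + X) => abs.
have s01 : (0 <= s) && (s <= u).
  rewrite lgroup_sumr_ge0//= (le_trans _ (mv_le a))// abs -[leLHS]add0r.
  exact: lgroup_leD.
by rewrite (fD _ (b i) (MV s01))// (IH (MV s01)).
Qed.

Lemma iter_mv_additive (tau : mv u -> mv u) (n : nat) :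
  mv_additive (fun a => mv_val (tau a)) ->
  mv_additive (fun a => mv_val (iter n tau a)).
Proof. by move=> tauD; elim: n => // n IH a b c /IH; exact: tauD. Qed.

(** The array [e] splits each [a i] into pieces indexed by [J], while [c] splits
    it into pieces indexed by the fibre of [p] over [i]; common refinements of
    these two splittings, for all [i], split [c] compatibly with [e]. *)
Lemma mv_coupling (T I J : finType) (c : T -> mv u) (p : T -> I)
    (a : I -> mv u) (e : I -> J -> mv u) :
  (forall i, \sum_(t | p t == i) mv_val (c t) = mv_val (a i)) ->
  (forall i, \sum_j mv_val (e i j) = mv_val (a i)) ->
  exists d : T -> J -> mv u,
    (forall t, \sum_j mv_val (d t j) = mv_val (c t)) /\
    (forall i j, \sum_(t | p t == i) mv_val (d t j) = mv_val (e i j)).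
Proof.
move=> ca ea.
(* The fibre over [i] is encoded by extending [c] by zero outside of it. *)
pose x i t : G := if p t == i then mv_val (c t) else 0.
pose y i j : G := mv_val (e i j).
have x0 i t : 0 <= x i t by rewrite /x; case: ifP => _ //; exact: mv_ge0.
have y0 i j : 0 <= y i j by exact: mv_ge0.
have xy i : \sum_t x i t = \sum_j y i j by rewrite -big_mkcond ca ea.
have xE t : x (p t) t = mv_val (c t) by rewrite /x eqxx.
have dP t j : (0 <= riesz (x (p t)) (y (p t)) t j) &&
              (riesz (x (p t)) (y (p t)) t j <= u).
  rewrite riesz_ge0//= (le_trans _ (mv_le (c t)))// -xE.
  rewrite -[leRHS](riesz_suml (x0 _) (xy _)).
  by apply: lgroup_ler_sumD1 => // j'; exact: riesz_ge0.
exists (fun t j => MV (dP t j)); split => [t|i j] /=.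
  by rewrite riesz_suml.
rewrite -[RHS](riesz_sumr (y0 i) (xy i)) [RHS](bigID (fun t => p t == i))/=.
rewrite [X in _ = _ + X]big1 ?addr0 => [|t /negbTE pt].
  by apply: eq_bigr => t /eqP ->.
(* Outside the fibre the coupling is squeezed between 0 and [x i t = 0]. *)
apply/le_anti; rewrite riesz_ge0// andbT.
have <- : x i t = 0 by rewrite /x pt.
rewrite -[leRHS](riesz_suml (x0 i) (xy i)).
by apply: lgroup_ler_sumD1 => // j'; exact: riesz_ge0.
Qed.

End Additive.

(** * Entropy inequalities for finite arrays of reals *)

Section RealEntropy.
Variable R : realType.
Implicit Types x y z : R.

Lemma phiE x : 0 <= x -> phi x = - (x * ln x).
Proof.
rewrite /phi le_eqVlt => /predU1P[<-|->//].
by rewrite ltxx mul0r oppr0.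
Qed.

Lemma phi_ge0 x : 0 <= x <= 1 -> 0 <= phi x.
Proof.
by move=> /andP[x0 x1]; rewrite phiE// -mulrN mulr_ge0// oppr_ge0 ln_le0.
Qed.

(** The termwise form of Gibbs' inequality, that is [ln z <= z - 1] at
    [z = y / x]; the error term [y - x] disappears when it is summed over two
    families with the same total. *)
Lemma phi_gibbs x y : 0 <= x -> 0 <= y -> (0 < x -> 0 < y) ->
  phi x <= - (x * ln y) + (y - x).
Proof.
rewrite le_eqVlt => /predU1P[<- y0 _|x0 y0 /(_ x0) {}y0].
  by rewrite /phi ltxx mul0r oppr0 add0r addr0.
rewrite (phiE (ltW x0)) -lerBlDl opprK addrC -mulrBr -ln_div ?posrE//.
have yx : -1 < y / x - 1 by rewrite -ltrBlDr opprK addNr divr_gt0.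
have := le_ln1Dx yx; rewrite addrC subrK -(ler_pM2l x0) => /le_trans; apply.
by rewrite mulrBr mulr1 mulrCA divff ?gt_eqF// mulr1.
Qed.

(** Merging cells does not increase the entropy, as each [ln (x i)] is at most
    the logarithm of the sum. *)
Lemma phi_sum_le (I : finType) (P : pred I) (x : I -> R) :
  (forall i, 0 <= x i) ->
  phi (\sum_(i | P i) x i) <= \sum_(i | P i) phi (x i).
Proof.
move=> x0; rewrite phiE ?sumr_ge0// mulr_suml -sumrN; apply: ler_sum => i Pi.
rewrite phiE// lerN2; have := x0 i; rewrite le_eqVlt => /predU1P[<-|xi].
  by rewrite !mul0r.
have le : x i <= \sum_(i | P i) x i.
  by rewrite (bigD1 i)//= lerDl sumr_ge0.
by rewrite ler_pM2l// ler_ln ?posrE// (lt_le_trans xi).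
Qed.

(** Let [X], [Z] have joint law [d]; then [c] is the law of [X], [e] that of
    [(p X, Z)] and [a] that of [p X], so this is
    [H(X, Z) <= H(X) + H(Z | p X)].  It is Gibbs' inequality for the law [d]
    and the law [c t * (e (p t) j / a (p t))], under which [X] and [Z] are
    conditionally independent given [p X]. *)
Lemma entropy_chain_le (T I J : finType) (p : T -> I) (c : T -> R) (a : I -> R)
    (e : I -> J -> R) (d : T -> J -> R) :
  (forall t j, 0 <= d t j) ->
  (forall t, \sum_j d t j = c t) ->
  (forall i j, \sum_(t | p t == i) d t j = e i j) ->
  (forall i, \sum_j e i j = a i) ->
  \sum_t \sum_j phi (d t j) <=
    \sum_t phi (c t) + \sum_i \sum_j a i * phi (e i j / a i).
Proof.
move=> d0 dc de ea.
have c0 t : 0 <= c t by rewrite -dc sumr_ge0.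
have e0 i j : 0 <= e i j by rewrite -de sumr_ge0.
have a0 i : 0 <= a i by rewrite -ea sumr_ge0.
have dlec t j : d t j <= c t by rewrite -dc (bigD1 j)//= lerDl sumr_ge0.
have dlee t j : d t j <= e (p t) j by rewrite -de (bigD1 t)//= lerDl sumr_ge0.
have elea i j : e i j <= a i by rewrite -ea (bigD1 j)//= lerDl sumr_ge0.
pose f i j := e i j / a i.
have f0 i j : 0 <= f i j by rewrite divr_ge0.
have H t j : phi (d t j) <= - (d t j * ln (c t)) - d t j * ln (f (p t) j)
                             + (c t * f (p t) j - d t j).
  have := d0 t j; rewrite le_eqVlt => /predU1P[<-|dp].
    by rewrite /phi ltxx !mul0r oppr0 !addr0 add0r mulr_ge0.
  have cp := lt_le_trans dp (dlec t j).
  have ep := lt_le_trans dp (dlee t j).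
  have ap := lt_le_trans ep (elea _ _).
  have fp : 0 < f (p t) j by rewrite divr_gt0.
  rewrite -opprD -mulrDr -lnM ?posrE//.
  apply: phi_gibbs => [||_]; [exact: d0|exact: mulr_ge0|exact: mulr_gt0].
apply: le_trans (ler_sum _ (fun t _ => ler_sum _ (fun j _ => H t j))) _.
under eq_bigr do rewrite big_split/= big_split/=.
(* Of the three groups of terms of [H], the first sums up to [H(X)], the second
   to [H(Z | p X)], and the sum of the third is at most 0. *)
rewrite big_split/= big_split/= -addrA; apply: lerD.
  by apply: ler_sum => t _; rewrite phiE// sumrN -mulr_suml dc.
rewrite -[leRHS]addr0; apply: lerD; last first.
  apply: sumr_le0 => t _; rewrite sumrB -mulr_sumr dc -mulr_suml ea.
  have [->|a1] := eqVneq (a (p t)) 0.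
    by rewrite mul0r mulr0 sub0r oppr_le0.
  by rewrite divff// mulr1 subrr.
rewrite (partition_big p xpredT)//=; apply: ler_sum => i _.
rewrite exchange_big/=; apply: ler_sum => j _.
rewrite -/(f i j) phiE// mulrN mulrA [a i * _]mulrCA.
have -> : e i j * (a i / a i) = e i j.
  have [a1|a1] := eqVneq (a i) 0; last by rewrite divff// mulr1.
  have /eqP : e i j = 0 by apply/le_anti; rewrite e0 -[leRHS]a1 elea.
  by move=> /eqP ->; rewrite mul0r.
rewrite -de mulr_suml -sumrN; apply: ler_sum => t /eqP pt.
by rewrite pt.
Qed.

End RealEntropy.

(** * Fekete's lemma *)

Section Fekete.
Variable R : realType.

(** The limit is the infimum of the quotients over [n > 0]: if [v p / p] is
    close to it, division of [n] by [p] gives [v n <= q * v p + M], where [M]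
    bounds the values of [v] at the possible remainders.  Remainders are taken
    in [1, p] rather than [0, p - 1], as subadditivity is assumed at positive
    indices. *)
Lemma fekete_cvg (v : nat -> R) : (forall n, 0 <= v n) ->
  (forall p q, v (p.+1 + q.+1)%N <= v p.+1 + v q.+1) ->
  cvgn (fun n => n%:R^-1 * v n).
Proof.
move=> v0 vD; pose w n := n%:R^-1 * v n.
pose E := range (fun n => w n.+1).
have w0 n : 0 <= w n by rewrite mulr_ge0// invr_ge0.
have Elb : has_lbound E by exists 0 => _ [n _ <-].
have Einf : has_inf E by split => //; exists (w 1%N), 0%N.
have Lw n : (0 < n)%N -> inf E <= w n.
  by case: n => // n _; apply: ge_inf => //; exists n.
apply/cvg_ex; exists (inf E); apply/cvgrPdist_le => eps eps0.
have [_ [p _ <-] wp] := inf_adherent (divr_gt0 eps0 (ltr0Sn R 1)) Einf.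
pose M := \sum_(r < p.+1) v r.+1.
have M0 : 0 <= M by exact: sumr_ge0.
have vq q r : v (q * p.+1 + r.+1)%N <= q%:R * v p.+1 + v r.+1.
  elim: q => [|q IH]; first by rewrite mul0n add0n mul0r add0r.
  rewrite mulSn -addnA addnS (le_trans (vD _ _))// -addnS.
  by rewrite -[q.+1]addn1 natrD mulrDl mul1r addrAC [leRHS]addrC lerD2l.
near=> n; have n0 : (0 < n)%N by near: n; exact: nbhs_infty_gt.
have n0R : 0 < n%:R :> R by rewrite ltr0n.
rewrite distrC ger0_norm ?subr_ge0 ?Lw// lerBlDl -/(w n).
have wn : w n <= w p.+1 + M / n%:R.
  rewrite /w -(ler_pM2l n0R) mulrA divff ?gt_eqF// mul1r mulrDr.
  rewrite [n%:R * (M / _)]mulrCA divff ?gt_eqF// mulr1.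
  rewrite -{1}(prednK n0) {1}(divn_eq n.-1 p.+1) -addnS.
  rewrite (le_trans (vq _ _))// lerD//.
    rewrite mulrA ler_wpM2r// ler_pdivlMr ?ltr0n// -natrM ler_nat.
    by rewrite (leq_trans (leq_divM _ _))// leq_pred.
  have rp : (n.-1 %% p.+1 < p.+1)%N by rewrite ltn_mod.
  by rewrite /M (bigD1 (Ordinal rp))//= lerDl sumr_ge0.
have Mn : M / n%:R <= eps / 2.
  rewrite ler_pdivrMr// mulrC -ler_pdivrMr ?divr_gt0//.
  by near: n; exact: nbhs_infty_ger.
by rewrite (le_trans wn)// [eps]splitr addrA lerD// ltW.
Unshelve. all: by end_near.
Qed.

End Fekete.

(** * Refinements indexed by arbitrary finite types *)

Lemma sum_unit (V : nmodType) (f : unit -> V) : \sum_i f i = f tt.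
Proof. by rewrite (bigD1 tt)//= big_pred0 ?addr0// => -[]. Qed.

Section Pairs.
Variables (V : nmodType) (T J : finType) (f : T * J -> V).

Lemma sum_fst (P : pred T) :
  \sum_(x | P x.1) f x = \sum_(t | P t) \sum_j f (t, j).
Proof.
by rewrite pair_big/=; apply: eq_big => [x|[]//]; rewrite andbT.
Qed.

Lemma sum_snd (P : pred J) :
  \sum_(x | P x.2) f x = \sum_(j | P j) \sum_t f (t, j).
Proof. by rewrite exchange_big pair_big/=; apply: eq_bigr => -[]. Qed.

End Pairs.

Section Refinements.
Variables (R : realType) (G : lgroupType) (u : G) (hu : strong_unit u).
Variables (m : mv u -> R) (hm : state hu m).

Lemma state_ge0 a : 0 <= m a.
Proof. by case/andP: (state_in01 hm a). Qed.

Lemma state_sum (I : finType) (P : pred I) (b : I -> mv u) (a : mv u) :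
  mv_val a = \sum_(i | P i) mv_val (b i) -> m a = \sum_(i | P i) m (b i).
Proof. by apply: mv_additive_sum; exact: (stateD hm). Qed.

Lemma entropy_ge0 (I : finType) (c : I -> mv u) : 0 <= entropy m c.
Proof. by apply: sumr_ge0 => i _; exact/phi_ge0/(state_in01 hm). Qed.

Lemma partition_inhabited (I : finType) (a : I -> mv u) :
  partition_of_unity a -> inhabited I.
Proof.
move=> au; have [i _|I0] := pickP (@predT I); first by exists.
have := state_sum (a := mv_top hu) (esym au).
by rewrite big_pred0// (state1 hm) => /eqP; rewrite oner_eq0.
Qed.

(** For [e i j = a_i b_j] this is [H(B || A)]. *)
Definition cond_entropy (I J : finType) (a : I -> mv u) (e : I -> J -> mv u) :=
  \sum_i \sum_j m (a i) * phi (m (e i j) / m (a i)).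

(** The pieces of a coupling are arrays of reals to which [entropy_chain_le]
    applies, because [m] commutes with the marginal sums. *)
Lemma entropy_coupling (T I J : finType) (c : T -> mv u) (p : T -> I)
    (a : I -> mv u) (e : I -> J -> mv u) :
  (forall i, \sum_(t | p t == i) mv_val (c t) = mv_val (a i)) ->
  (forall i, \sum_j mv_val (e i j) = mv_val (a i)) ->
  exists d : T * J -> mv u,
    [/\ forall t, \sum_j mv_val (d (t, j)) = mv_val (c t),
        forall i j, \sum_(t | p t == i) mv_val (d (t, j)) = mv_val (e i j)
      & entropy m d <= entropy m c + cond_entropy a e].
Proof.
move=> ca ea; have [d [dc de]] := mv_coupling ca ea.
exists (fun x => d x.1 x.2); split=> //.
rewrite /entropy -(pair_bigA _ (fun t j => phi (m (d t j))))/=.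
apply: (entropy_chain_le (p := p)).
- by move=> t j; exact: state_ge0.
- by move=> t; rewrite (state_sum (esym (dc t))).
- by move=> i j; rewrite (state_sum (esym (de i j))).
- by move=> i; rewrite (state_sum (esym (ea i))).
Qed.

(** Refinements indexed by an arbitrary finite type [T], the map [p s] giving
    the cell of the [s]-th partition to which an index belongs.  Unlike arrays
    indexed by tuples, they can be refined by passing from [T] to [T * J].
    The total is prescribed because the marginals do not determine it when
    [n = 0]. *)
Definition refines (n : nat) (I T : finType) (a : nat -> I -> mv u)
    (p : nat -> T -> I) (c : T -> mv u) :=
  partition_of_unity c /\ forall s, (s < n)%N -> forall i,
    \sum_(t | p s t == i) mv_val (c t) = mv_val (a s i).

Lemma refines_marginal (n : nat) (I J T : finType) (a : nat -> I -> mv u)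
    (p : nat -> T -> I) (c : T -> mv u) (d : T * J -> mv u) :
  (forall t, \sum_j mv_val (d (t, j)) = mv_val (c t)) ->
  refines n a p c -> refines n a (fun s x => p s x.1) d.
Proof.
move=> dc [cu ca]; split=> [|s sn i].
  rewrite /partition_of_unity (sum_fst (fun x => mv_val (d x)) xpredT).
  by rewrite -[RHS]cu; apply: eq_bigr.
rewrite -ca// (sum_fst (fun x => mv_val (d x)) (fun t => p s t == i)).
exact: eq_bigr.
Qed.

(** Iterated coupling.  A refinement of the [a s] stays one when it is refined
    further, so the array [e s] can be coupled to it for each [s] in turn. *)
Lemma refines_coupling (n : nat) (T I J : finType) (c : T -> mv u)
    (p : nat -> T -> I) (a : nat -> I -> mv u) (b : nat -> J -> mv u)
    (e : nat -> I -> J -> mv u) :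
  inhabited J -> refines n a p c ->
  (forall s i, \sum_j mv_val (e s i j) = mv_val (a s i)) ->
  (forall s j, \sum_i mv_val (e s i j) = mv_val (b s j)) ->
  exists (T' : finType) (q : nat -> T' -> J) (d : T' -> mv u),
    refines n b q d /\
    entropy m d <= entropy m c + \sum_(s < n) cond_entropy (a s) (e s).
Proof.
move=> [j0] ca ea eb.
suff: forall N, (N <= n)%N ->
    exists (T' : finType) (p' : nat -> T' -> I) (q : nat -> T' -> J)
      (d : T' -> mv u),
    [/\ refines n a p' d, refines N b q d &
    entropy m d <= entropy m c + \sum_(s < N) cond_entropy (a s) (e s)].
  by move=> /(_ _ (leqnn n))[T' [_ [q [d [_ db dH]]]]]; exists T', q, d.
elim=> [_|N IH Nn].
  (* No condition bears on [q] before the first step, so [j0] is arbitrary. *)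
  exists T, p, (fun _ _ => j0), c; split=> //; last by rewrite big_ord0 addr0.
  by split=> //; case: ca.
have [T' [p' [q [d [da db dH]]]]] := IH (ltnW Nn).
have [d' [dd' de' dH']] := entropy_coupling (da.2 N Nn) (ea N).
exists (T' * J)%type, (fun s x => p' s x.1).
exists (fun s x => if s == N then x.2 else q s x.1), d'; split.
- exact: refines_marginal da.
- split; first exact: (refines_marginal dd' da).1.
  move=> s; rewrite ltnS leq_eqVlt => /predU1P[->|sN] j.
    rewrite eqxx (sum_snd (fun x => mv_val (d' x)) (pred1 j)) big_pred1_eq.
    rewrite (partition_big (p' N) xpredT)//= -eb.
    by apply: eq_bigr => i _; exact: de'.
  by rewrite ltn_eqF//; exact: (refines_marginal dd' db).2.
- by rewrite big_ord_recr/= addrA (le_trans dH')// lerD2r.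
Qed.

(** Merging the indices [t] that have the same cells [(p s t)_s] turns a
    refinement into an array indexed by tuples, and does not increase the
    entropy. *)
Lemma refines_common (n k : nat) (a : nat -> 'I_k -> mv u) (T : finType)
    (p : nat -> T -> 'I_k) (c : T -> mv u) : refines n a p c ->
  exists2 c' : {dffun forall s : 'I_n, 'I_k} -> mv u,
    common_refinement (fun s => a s) c' & entropy m c' <= entropy m c.
Proof.
move=> [cu ca].
pose F t : {dffun forall s : 'I_n, 'I_k} := [ffun s : 'I_n => p s t].
have c01 i : (0 <= \sum_(t | F t == i) mv_val (c t)) &&
             (\sum_(t | F t == i) mv_val (c t) <= u).
  have c0 t : 0 <= mv_val (c t) by exact: mv_ge0.
  by rewrite lgroup_sumr_ge0//= -[leRHS]cu lgroup_ler_sum_sub.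
exists (fun i => MV (c01 i)) => [s j|].
  rewrite -ca// (partition_big F (fun i => i s == j))/=.
    apply: eq_bigr => i /eqP ij; apply: eq_bigl => t.
    apply/idP/andP => [/eqP Ft|[]//]; split; last exact/eqP.
    by rewrite -ij -Ft ffunE.
  by move=> t; rewrite ffunE.
rewrite /entropy [leRHS](partition_big F xpredT)//=; apply: ler_sum => i _.
rewrite (state_sum (a := MV (c01 i)) (b := c) erefl).
by apply: phi_sum_le => t; exact: state_ge0.
Qed.

(** * Subadditivity and existence of the dynamical entropy *)

Section Dynamics.
Variables (tau : mv u -> mv u) (hds : dynamical_system hu m tau).

Lemma iter_additive n : mv_additive (fun a => mv_val (iter n tau a)).
Proof. exact/iter_mv_additive/(dynamical_systemD hds). Qed.

Lemma iter_sum n (I : finType) (P : pred I) (b : I -> mv u) (a : mv u) :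
  \sum_(i | P i) mv_val (b i) = mv_val a ->
  \sum_(i | P i) mv_val (iter n tau (b i)) = mv_val (iter n tau a).
Proof.
by move=> ab; rewrite (mv_additive_sum (@iter_additive n) (esym ab)).
Qed.

Lemma iter_top n : iter n tau (mv_top hu) = mv_top hu.
Proof. by elim: n => //= n ->; exact: dynamical_system1 hds. Qed.

Lemma iter_invariant n a : m (iter n tau a) = m a.
Proof. by elim: n => //= n; rewrite (dynamical_system_invariant hds). Qed.

Lemma iter_partition n (I : finType) (a : I -> mv u) :
  partition_of_unity a -> partition_of_unity (fun i => iter n tau (a i)).
Proof. by move=> /(iter_sum (a := mv_top hu) n); rewrite iter_top. Qed.

Variables (k : nat) (A : 'I_k -> mv u) (hA : partition_of_unity A).
Let tauA s i := iter s tau (A i).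

Lemma refinement_entropy_le n (T : finType) (p : nat -> T -> 'I_k)
    (c : T -> mv u) :
  refines n tauA p c -> refinement_entropy m tau A n <= entropy m c.
Proof.
move=> /refines_common[c' cc' cH]; apply: le_trans cH; apply: ge_inf.
  by exists 0 => _ [d _ <-]; exact: entropy_ge0.
by exists c'.
Qed.

(** Together with [refinement_entropy_le], this computes [H_n] as the infimum
    over all finite index types.  The infimum has to be over a nonempty set: a
    refinement is obtained by coupling the partitions [tau^s A] over the
    trivial partition. *)
Lemma refinement_entropy_ge n (x : R) :
  (forall (T : finType) (p : nat -> T -> 'I_k) (c : T -> mv u),
    refines n.+1 tauA p c -> x <= entropy m c) ->
  x <= refinement_entropy m tau A n.+1.
Proof.
move=> xc; apply: lb_le_inf.
  have [T [q [d [dA _]]]] : exists (T' : finType) (q : nat -> T' -> 'I_k)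
      (d : T' -> mv u), refines n.+1 tauA q d /\ entropy m d <=
      entropy m (fun _ : unit => mv_top hu) + \sum_(s < n.+1)
        cond_entropy (fun _ : unit => mv_top hu) (fun _ => tauA s).
    apply: (refines_coupling (p := fun _ _ => tt) (a := fun _ _ => mv_top hu)
      (e := fun s _ => tauA s)).
    - exact: partition_inhabited hA.
    - by split=> [|s _ []]; rewrite /partition_of_unity sum_unit.
    - by move=> s i; exact: iter_partition hA.
    - by move=> s j; rewrite sum_unit.
  have [d' dA' _] := refines_common dA.
  by exists (entropy m d'), d'.
pose I := {dffun forall s : 'I_n.+1, 'I_k}.
(* [inord s] turns [s] into an ordinal; its value for [s > n] is irrelevant. *)
move=> _ [c cA <-]; apply: (xc I (fun s (t : I) => t (inord s)) c).
split=> [|s sn j]; last by rewrite -[s in RHS](inordK sn); exact: cA.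
rewrite /partition_of_unity.
rewrite (partition_big (fun t : I => t ord0) xpredT)//=.
by rewrite -[RHS](iter_partition 0 hA); apply: eq_bigr => j _; exact: cA.
Qed.

Lemma refinement_entropy_ge0 n : 0 <= refinement_entropy m tau A n.
Proof.
rewrite /refinement_entropy; set E := (X in inf X).
have [->|/set0P E0] := eqVneq E set0; first by rewrite inf0.
by apply: lb_le_inf => // _ [c _ <-]; exact: entropy_ge0.
Qed.

(** If [c] refines the first [p] partitions and [c'] the first [q], then a
    coupling of [c] with [tau^p c'] refines the first [p + q]; over the trivial
    partition, the conditional entropy of [tau^p c'] is its entropy, which
    is that of [c']. *)
Lemma refinement_entropy_subadditive p q :
  refinement_entropy m tau A (p.+1 + q.+1)
    <= refinement_entropy m tau A p.+1 + refinement_entropy m tau A q.+1.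
Proof.
rewrite -lerBlDr; apply: refinement_entropy_ge => T f c [cu cA].
rewrite lerBlDr -lerBlDl; apply: refinement_entropy_ge => T' f' c' [cu' cA'].
rewrite lerBlDl.
have c'u : partition_of_unity (fun t => iter p.+1 tau (c' t)).
  exact: iter_partition.
have cu1 (i : unit) : \sum_(t | tt == i) mv_val (c t) = mv_val (mv_top hu).
  by case: i; rewrite -[RHS]cu; apply: eq_bigl.
have [d [dc dc' dH]] := entropy_coupling cu1 (fun=> c'u).
have -> : entropy m c' = cond_entropy (fun=> mv_top hu)
    (fun (_ : unit) t => iter p.+1 tau (c' t)).
  rewrite /cond_entropy sum_unit; apply: eq_bigr => t _.
  by rewrite (state1 hm) iter_invariant divr1 mul1r.
apply: le_trans dH; have [du dA] := refines_marginal dc (conj cu cA).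
apply: (refinement_entropy_le
  (p := fun s x => if (s < p.+1)%N then f s x.1 else f' (s - p.+1)%N x.2)).
split=> // s spq j; case: ltnP => [sp|ps]; first exact: dA.
rewrite (sum_snd (fun x => mv_val (d x)) (fun t => f' (s - p.+1)%N t == j)).
rewrite -(subnKC ps) addKn /tauA iterD.
have sq : (s - p.+1 < q.+1)%N by rewrite ltn_subLR.
rewrite -(iter_sum p.+1 (cA' _ sq j)); apply: eq_bigr => t _.
by rewrite -(dc' tt); apply: eq_bigl.
Qed.

Lemma dynamical_entropy_cvg :
  n%:R^-1 * refinement_entropy m tau A n @[n --> \oo]
    --> dynamical_entropy m tau A.
Proof.
exact: (fekete_cvg refinement_entropy_ge0 refinement_entropy_subadditive).
Qed.

End Dynamics.

(** * The entropy inequality *)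

(** Each of the couplings costs the same [cond_entropy A e], as [m] is
    invariant. *)
Lemma refinement_entropy_conditional (tau : mv u -> mv u) (k l : nat)
    (A : 'I_k -> mv u) (B : 'I_l -> mv u) (e : 'I_k -> 'I_l -> mv u) (n : nat) :
  dynamical_system hu m tau -> partition_of_unity A -> partition_of_unity B ->
  (forall i, \sum_j mv_val (e i j) = mv_val (A i)) ->
  (forall j, \sum_i mv_val (e i j) = mv_val (B j)) ->
  refinement_entropy m tau B n.+1 <=
    refinement_entropy m tau A n.+1 + cond_entropy A e *+ n.+1.
Proof.
move=> hds hA hB eA eB; rewrite -lerBlDr.
apply: (refinement_entropy_ge hds hA) => T p c cA; rewrite lerBlDr.
have [||| T' [q [d [dB dH]]]] := refines_coupling
  (e := fun s i j => iter s tau (e i j))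
  (b := fun s j => iter s tau (B j)) _ cA.
- exact: partition_inhabited hB.
- by move=> s i; exact: iter_sum.
- by move=> s j; exact: iter_sum.
apply: le_trans (refinement_entropy_le dB) (le_trans dH _).
rewrite lerD2l -[X in _ *+ X]card_ord -sumr_const; apply: ler_sum => s _.
rewrite /cond_entropy ler_sum// => i _; apply: ler_sum => j _.
by rewrite !(iter_invariant hds).
Qed.

End Refinements.

Theorem theorem4 (R : realType) (G : lgroupType) (u : G) (hu : strong_unit u)
    (hdiv : mv_divisible u) (hsigma : mv_sigma_complete u)
    (op : mv u -> mv u -> mv u) (hop : mv_product hu op)
    (m : mv u -> R) (tau : mv u -> mv u) (hds : dynamical_system hu m tau)
    (hcont : state_continuous m) (hpos : state_positive m)
    (k : nat) (A : 'I_k -> mv u) (hA : partition_of_unity A)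
    (hAid : forall i : 'I_k, mv_idempotent (A i))
    (l : nat) (B : 'I_l -> mv u) (hB : partition_of_unity B) :
  dynamical_entropy m tau B
    <= dynamical_entropy m tau A + conditional_entropy op m A B.
Proof.
have hm := dynamical_system_state hds.
have mulD a : mv_additive (fun b => mv_val (op a b)).
  by move=> s b c /(mv_productDr hop a)[].
have opC := mv_productC hop.
have eA i : \sum_j mv_val (op (A i) (B j)) = mv_val (A i).
  have /= <- := mv_additive_sum (a := mv_top hu) (mulD (A i)) (esym hB).
  by rewrite opC (mv_product1 hop).
have eB j : \sum_i mv_val (op (A i) (B j)) = mv_val (B j).
  under eq_bigr do rewrite opC.
  have /= <- := mv_additive_sum (a := mv_top hu) (mulD (B j)) (esym hA).
  by rewrite opC (mv_product1 hop).
apply: (ler_cvg_to (dynamical_entropy_cvg hm hds hB)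
  (cvgD (dynamical_entropy_cvg hm hds hA) (cvg_cst _))).
exists 1%N => // -[//|n] _; rewrite /= fctE.
have n0 : 0 < n.+1%:R :> R by rewrite ltr0n.
rewrite -(ler_pM2l n0) mulrDr !mulrA divff ?gt_eqF// !mul1r mulr_natl.
exact: (refinement_entropy_conditional hm n hds hA hB eA eB).
Qed.
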